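(* Let $\bar M={}_fI\times_\sigma M$ be a doubly warped spacetime with metric $\bar g=-f^2dt^2\oplus\sigma^2g$. A vector field $\bar\zeta=h\partial_t+\zeta$ on $\bar M$ is a concurrent vector field if (1) $\zeta$ and $h\partial_t$ are concurrent vector fields on $M$ and $I$ respectively, and (2) both $f$ and $\sigma$ are constant.
   Context: $(M,g)$ is a Riemannian manifold, $I$ is an open connected interval with metric $-dt^2$, and $f:M\to(0,\infty)$, $\sigma:I\to(0,\infty)$ are smooth. The doubly warped spacetime ${}_fI\times_\sigma M$ is $I\times M$ with the metric $\bar g=-f^2dt^2\oplus\sigma^2g$. Here $h:I\to\mathbb R$ is smooth and $\zeta\in\mathfrak X(M)$ (identified with its lift). A vector field $\zeta$ on a pseudo-Riemannian manifold $(N,k)$ with Levi-Civita connection $D$ is concurrent if $D_X\zeta=X$ for every $X\in\mathfrak X(N)$. *)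

(* Defs.v *)
From HB Require Import structures.
From mathcomp Require Import all_boot all_order all_algebra.
From mathcomp Require Import all_classical all_reals all_analysis.
Set Implicit Arguments.
Unset Strict Implicit.
Unset Printing Implicit Defensive.
Import Order.TTheory GRing.Theory Num.Theory.
Import numFieldNormedType.Exports.
Local Open Scope classical_set_scope.
Local Open Scope ring_scope.

(* C^oo on U: iterated directional derivatives of every order are Frechet
   differentiable at every point of U. It is only used with U open. *)
Definition smooth_on (R : realType) (V W : normedModType R) (U : set V)
    (F : V -> W) : Prop :=
  forall (vs : seq V) (x : V), U x ->
    differentiable (foldr (fun v G => 'D_v G) F vs) x.

(* Charts are partial bijections between T and R^n: [coord i] is meaningful
   on [dom i], and [point i] is its inverse, equal to [None] off the range of
   the chart. [chart_at p] is a preferred chart around p; it identifies the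
   tangent space T_pN with 'rV[R]_n by taking components in that chart. *)
Record atlas (R : realType) (T : Type) (n : nat) := Atlas {
  chart : Type;
  dom : chart -> set T;
  coord : chart -> T -> 'rV[R]_n;
  point : chart -> 'rV[R]_n -> option T;
  chart_at : T -> chart }.

Section Manifold.
Context {R : realType} {n : nat}.

Section Charts.
Context {T : Type} (A : atlas R T n).

Definition chart_range (i : chart A) : set 'rV[R]_n := coord i @` dom i.

(* F \o phi_i^-1, extended by 0 off the range of the chart. *)
Definition in_coord {W : normedModType R} (i : chart A) (F : T -> W)
    (x : 'rV[R]_n) : W :=
  oapp F 0 (point i x).

Definition transition (i j : chart A) : 'rV[R]_n -> 'rV[R]_n :=
  in_coord i (coord j).

Definition smooth_fun (F : T -> R) : Prop :=
  forall i, smooth_on (chart_range i) (in_coord i F : 'rV[R]_n -> R^o).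

(* The tangent vector v at p, given by its components in [chart_at p], has
   components v *m 'J(phi_i \o phi_(chart_at p)^-1) in the chart i. *)
Definition field_comp (i : chart A) (X : T -> 'rV[R]_n) (p : T) : 'rV[R]_n :=
  X p *m 'J (transition (chart_at A p) i) (coord (chart_at A p) p).

Definition smooth_field (X : T -> 'rV[R]_n) : Prop :=
  forall i, smooth_on (chart_range i) (in_coord i (field_comp i X)).

(* X(F) *)
Definition field_app (X : T -> 'rV[R]_n) (F : T -> R) (p : T) : R :=
  'D_(X p) (in_coord (chart_at A p) F : 'rV[R]_n -> R^o)
           (coord (chart_at A p) p).

(* [X, Y]^k = X(Y^k) - Y(X^k) in the chart [chart_at p]. *)
Definition lie_bracket (X Y : T -> 'rV[R]_n) (p : T) : 'rV[R]_n :=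
  let c := chart_at A p in
  'D_(X p) (in_coord c (field_comp c Y)) (coord c p)
  - 'D_(Y p) (in_coord c (field_comp c X)) (coord c p).

(* A (0,2)-tensor field b is given at p by its matrix in the chart
   [chart_at p]; this is its matrix in the chart i. *)
Definition tensor_comp (i : chart A) (b : T -> 'M[R]_n) (p : T) : 'M[R]_n :=
  let P := 'J (transition i (chart_at A p)) (coord i p) in
  P *m b p *m P^T.

Definition smooth_tensor (b : T -> 'M[R]_n) : Prop :=
  forall i, smooth_on (chart_range i) (in_coord i (tensor_comp i b)).

Definition pairing (b : T -> 'M[R]_n) (X Y : T -> 'rV[R]_n) (p : T) : R :=
  (X p *m b p *m (Y p)^T) 0 0.

Definition riemannian_metric (g : T -> 'M[R]_n) : Prop :=
  [/\ smooth_tensor g,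
      forall p, (g p)^T = g p
    & forall p (v : 'rV[R]_n), v != 0 -> 0 < (v *m g p *m v^T) 0 0].

(* A connection acts on smooth vector fields; its values on functions
   T -> 'rV[R]_n that are not smooth vector fields are irrelevant. *)
Definition affine_connection
    (D : (T -> 'rV[R]_n) -> (T -> 'rV[R]_n) -> (T -> 'rV[R]_n)) : Prop :=
  (forall X Y, smooth_field X -> smooth_field Y -> smooth_field (D X Y)) /\
  [/\ forall X Y Z, smooth_field X -> smooth_field Y -> smooth_field Z ->
        D (X \+ Y) Z =1 D X Z \+ D Y Z,
      forall F X Y, smooth_fun F -> smooth_field X -> smooth_field Y ->
        D (fun p => F p *: X p) Y =1 (fun p => F p *: D X Y p),
      forall X Y Z, smooth_field X -> smooth_field Y -> smooth_field Z ->
        D X (Y \+ Z) =1 D X Y \+ D X Z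
    & forall F X Y, smooth_fun F -> smooth_field X -> smooth_field Y ->
        D X (fun p => F p *: Y p) =1
          (fun p => field_app X F p *: Y p + F p *: D X Y p)].

Definition torsion_free
    (D : (T -> 'rV[R]_n) -> (T -> 'rV[R]_n) -> (T -> 'rV[R]_n)) : Prop :=
  forall X Y, smooth_field X -> smooth_field Y ->
    D X Y \- D Y X =1 lie_bracket X Y.

Definition metric_compatible (g : T -> 'M[R]_n)
    (D : (T -> 'rV[R]_n) -> (T -> 'rV[R]_n) -> (T -> 'rV[R]_n)) : Prop :=
  forall X Y Z, smooth_field X -> smooth_field Y -> smooth_field Z ->
    field_app X (pairing g Y Z) =1
      pairing g (D X Y) Z \+ pairing g Y (D X Z).

Definition levi_civita (g : T -> 'M[R]_n)
    (D : (T -> 'rV[R]_n) -> (T -> 'rV[R]_n) -> (T -> 'rV[R]_n)) : Prop :=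
  [/\ affine_connection D, torsion_free D & metric_compatible g D].

Definition concurrent
    (D : (T -> 'rV[R]_n) -> (T -> 'rV[R]_n) -> (T -> 'rV[R]_n))
    (Z : T -> 'rV[R]_n) : Prop :=
  smooth_field Z /\ forall X, smooth_field X -> D X Z =1 X.

End Charts.

Definition smooth_manifold (T : topologicalType) (A : atlas R T n) : Prop :=
  [/\ hausdorff_space T, @second_countable T &
   [/\ forall i : chart A, open (dom i) /\
         (forall p, dom i p -> {for p, continuous (coord i)}) /\
         (forall U, open U -> U `<=` dom i -> open (coord i @` U)),
       forall (i : chart A) (x : 'rV[R]_n) (p : T),
         point i x = Some p <-> dom i p /\ coord i p = x,
       forall p, dom (chart_at A p) p
     & forall i j : chart A,
         smooth_on (coord i @` (dom i `&` dom j)) (transition i j)]].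

End Manifold.

Definition product_atlas (R : realType) (S T : Type) (m n : nat)
    (A : atlas R S m) (B : atlas R T n) : atlas R (S * T)%type (m + n) :=
  {| chart := (chart A * chart B)%type;
     dom := fun i => dom i.1 `*` dom i.2;
     coord := fun i p => row_mx (coord i.1 p.1) (coord i.2 p.2);
     point := fun i x =>
       if (point i.1 (lsubmx x), point i.2 (rsubmx x)) is (Some p, Some q)
       then Some (p, q) else None;
     chart_at := fun p => (chart_at A p.1, chart_at B p.2) |}.

(* The open interval I with its single chart t. *)
Definition interval_atlas (R : realType) (I : set R) : atlas R I 1 :=
  {| chart := unit;
     dom := fun _ => setT;
     coord := fun _ t => const_mx (set_val t);
     point := fun _ x => insub (x 0 0);
     chart_at := fun _ => tt |}.

(* h d/dt *)
Definition interval_field (R : realType) (I : set R) (h : I -> R) (t : I) :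
    'rV[R]_1 := const_mx (h t).

(* - dt^2 *)
Definition interval_metric (R : realType) (I : set R) (t : I) : 'M[R]_1 :=
  const_mx (-1).

(* The sum of the lifts of X and Y to the product. *)
Definition lift_sum (R : realType) (S T : Type) (m n : nat)
    (X : S -> 'rV[R]_m) (Y : T -> 'rV[R]_n) (p : S * T) : 'rV[R]_(m + n) :=
  row_mx (X p.1) (Y p.2).

(* f^2 gS (+) sigma^2 gT, with f on the second factor, sigma on the first. *)
Definition doubly_warped_metric (R : realType) (S T : Type) (m n : nat)
    (f : T -> R) (gS : S -> 'M[R]_m) (sigma : S -> R) (gT : T -> 'M[R]_n)
    (p : S * T) : 'M[R]_(m + n) :=
  block_mx (f p.2 ^+ 2 *: gS p.1) 0 0 (sigma p.1 ^+ 2 *: gT p.2).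

(* Main.v *)
(* When f and sigma are constant, the Levi-Civita connections of the factors
   combine into an explicit torsion-free metric connection D' on the product:
   differentiate in a product chart and add the Christoffel terms of each
   factor, evaluated on the slices of the two fields. With Z = h d/dt + zeta
   one gets D'_X Z = X, and the uniqueness of torsion-free metric connections
   gives gbar(W, Y) = 0 for W = D_X Z - X and every smooth Y. As W is itself
   smooth, its two components are legitimate choices of Y, and the metrics of
   the factors are definite, so W = 0; no bump functions are needed. *)
Require Import Defs.
From HB Require Import structures.
From mathcomp Require Import all_boot all_order all_algebra.
From mathcomp Require Import all_classical all_reals all_analysis.
From mathcomp Require Import lra.
Set Implicit Arguments.
Unset Strict Implicit.
Unset Printing Implicit Defensive.
Import Order.TTheory GRing.Theory Num.Theory.
Import numFieldNormedType.Exports.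
(* Otherwise [coord] and [point] would denote constants of the libraries. *)
Import Defs.
Local Open Scope classical_set_scope.
Local Open Scope ring_scope.

(** * Differential calculus *)

Section Calculus.
Context {R : realType} {V : normedModType R}.

(** Coordinate expressions are extended by 0 off the chart range, so identities between them hold
    only near a point. This lemma transfers differentiability along such local identities. *)
Lemma near_eq_differentiable (W : normedModType R) (F G : V -> W) (x : V) :
  {near x, F =1 G} -> differentiable F x -> differentiable G x.
Proof.
move=> FG dF; have [dFc FE] := (diff_locallyP _ _).1 dF.
(* By uniqueness of the differential, an expansion of [G] whose linear part is ['d F x] identifies
   that part as ['d G x]. *)
suff HG : G \o shift x = cst (G x) + 'd F x +o_ 0 id.
  by apply/diff_locallyP; rewrite (diff_unique dFc HG).
have /eqaddoP FE' := FE; apply/eqaddoP => e e0.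
have := FE' e e0.
rewrite -!nbhs_nearE; apply: filter_app.
have : \forall y \near (0 : V), F (y + x) = G (y + x).
  by have := FG; rewrite (near_shift 0) /=; apply: filterS => y; rewrite /= subr0.
apply: filter_app; near=> y => E.
by rewrite /= !fctE /= E (nbhs_singleton FG).
Unshelve. all: by end_near. Qed.

Lemma differentiable_mxP {m n : nat} (F : V -> 'M[R]_(m, n)) (x : V) :
  differentiable F x <-> forall i j, differentiable (fun y => F y i j : R^o) x.
Proof.
split=> [dF i j|dF].
  exact: (differentiable_comp dF (differentiable_coord _ _ _)).
have -> : F = \sum_i \sum_j (fun y => F y i j *: delta_mx i j).
  apply/funext => y; rewrite [LHS]matrix_sum_delta fct_sumE.
  by apply: eq_bigr => i _; rewrite fct_sumE.
by apply: differentiable_sum => i; apply: differentiable_sum => j; apply: differentiableZl.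
Qed.

Lemma differentiable_mulmx {m n p : nat} (F : V -> 'M[R]_(m, n))
    (G : V -> 'M[R]_(n, p)) (x : V) :
  differentiable F x -> differentiable G x ->
  differentiable (fun y => F y *m G y) x.
Proof.
move=> /differentiable_mxP dF /differentiable_mxP dG.
apply/differentiable_mxP => i j.
have -> : (fun y => (F y *m G y) i j) =
    \sum_k ((fun y => F y i k) * (fun y => G y k j)).
  by apply/funext => y; rewrite mxE fct_sumE.
by apply: differentiable_sum => k; apply: differentiableM.
Qed.

Lemma derive_mulmx {m n p : nat} (F : V -> 'M[R]_(m, n))
    (G : V -> 'M[R]_(n, p)) (x v : V) :
  differentiable F x -> differentiable G x ->
  'D_v (fun y => F y *m G y) x = 'D_v F x *m G x + F x *m 'D_v G x.
Proof.
move=> dF dG; have dFG := differentiable_mulmx dF dG.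
rewrite !derive_mx; [|exact: diff_derivable..].
move/differentiable_mxP: dF => dF; move/differentiable_mxP: dG => dG.
apply/matrixP => i j; rewrite !mxE.
have -> : (fun y => (F y *m G y) i j) =
    \sum_k ((fun y => F y i k) * (fun y => G y k j)).
  by apply/funext => y; rewrite mxE fct_sumE.
rewrite derive_sum; last by move=> k; apply/diff_derivable/differentiableM.
rewrite -big_split /=; apply: eq_bigr => k _.
rewrite deriveM; [|exact: diff_derivable..].
by rewrite !mxE addrC (mulrC _ (G x k j)).
Qed.

Lemma differentiable_trmx {m n : nat} (F : V -> 'M[R]_(m, n)) (x : V) :
  differentiable F x -> differentiable (fun y => (F y)^T) x.
Proof.
move=> /differentiable_mxP dF; apply/differentiable_mxP => i j.
by under eq_fun do rewrite mxE.
Qed.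

Lemma derive_trmx {m n : nat} (F : V -> 'M[R]_(m, n)) (x v : V) :
  differentiable F x -> 'D_v (fun y => (F y)^T) x = ('D_v F x)^T.
Proof.
move=> dF; have dFT := differentiable_trmx dF.
rewrite !derive_mx; [|exact: diff_derivable..].
apply/matrixP => i j; rewrite !mxE.
by under eq_fun do rewrite mxE.
Qed.

Lemma differentiable_row_mx {m n p : nat} (F : V -> 'M[R]_(m, n))
    (G : V -> 'M[R]_(m, p)) (x : V) :
  differentiable F x -> differentiable G x ->
  differentiable (fun y => row_mx (F y) (G y)) x.
Proof.
move=> /differentiable_mxP dF /differentiable_mxP dG.
by apply/differentiable_mxP => i j; under eq_fun do rewrite mxE; case: splitP.
Qed.

End Calculus.

(** * Stability of smoothness under linear and affine maps *)

Section SmoothOn.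
Context {R : realType}.
Implicit Types V W : normedModType R.

Lemma derive_comp_linear {V W W' : normedModType R} (L : {linear W -> W'})
    (F : V -> W) (x v : V) :
  continuous L -> differentiable F x -> 'D_v (L \o F) x = L ('D_v F x).
Proof.
move=> Lc dF; have dL : differentiable L (F x) by apply: linear_differentiable.
rewrite deriveE; last exact: differentiable_comp.
by rewrite diff_comp // diff_lin //= deriveE.
Qed.

Lemma iter_derive_eq_on {V W : normedModType R} (U : set V) (F G : V -> W)
    (vs : seq V) :
  open U -> {in U, F =1 G} ->
  {in U, foldr (fun v H => 'D_v H) F vs =1 foldr (fun v H => 'D_v H) G vs}.
Proof.
move=> oU FG; elim: vs => // v vs IH x /set_mem Ux /=.
apply: near_eq_derive; near=> y; apply/IH/mem_set.
by near: y; exact: open_nbhs_nbhs.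
Unshelve. all: by end_near. Qed.

Lemma open_near_eq {V W : normedModType R} (U : set V) (F G : V -> W) (x : V) :
  open U -> U x -> {in U, F =1 G} -> {near x, F =1 G}.
Proof.
move=> oU Ux FG; near=> y; apply/FG/mem_set.
by near: y; exact: open_nbhs_nbhs.
Unshelve. all: by end_near. Qed.

Lemma eq_smooth_on {V W : normedModType R} (U : set V) (F G : V -> W) :
  open U -> {in U, F =1 G} -> smooth_on U F -> smooth_on U G.
Proof.
move=> oU FG sF vs x Ux; apply: near_eq_differentiable (sF vs x Ux).
exact: open_near_eq (iter_derive_eq_on vs oU FG).
Qed.

Lemma smooth_on_cst {V W : normedModType R} (U : set V) (c : W) :
  smooth_on U (cst c : V -> W).
Proof.
(* The constant becomes 0 after one derivative, so the induction quantifies over its value. *)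
move=> vs x Ux; suff [k ->] : exists k, foldr (fun v H => 'D_v H) (cst c) vs = cst k.
  exact: differentiable_cst.
elim: vs => [|v vs [k /= ->]]; first by exists c.
by exists 0; apply/funext => y; rewrite derive_cst.
Qed.

Lemma smooth_on_linear {V W W' : normedModType R} (U : set V)
    (L : {linear W -> W'}) (F : V -> W) :
  open U -> continuous L -> smooth_on U F -> smooth_on U (L \o F).
Proof.
move=> oU Lc sF.
have iterL vs : {in U, L \o foldr (fun v H => 'D_v H) F vs
                  =1 foldr (fun v H => 'D_v H) (L \o F) vs}.
  elim: vs => // v vs IH x /set_mem Ux /=.
  rewrite -(derive_comp_linear v Lc (sF vs x Ux)).
  exact/near_eq_derive/(open_near_eq oU Ux IH).
move=> vs x Ux; apply: (near_eq_differentiable (open_near_eq oU Ux (iterL vs))).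
by apply: differentiable_comp; [exact: sF|exact: linear_differentiable].
Qed.

Lemma smooth_onD {V W : normedModType R} (U : set V) (F G : V -> W) :
  open U -> smooth_on U F -> smooth_on U G -> smooth_on U (F \+ G).
Proof.
move=> oU sF sG.
have iterD vs : {in U, foldr (fun v H => 'D_v H) F vs \+
      foldr (fun v H => 'D_v H) G vs =1 foldr (fun v H => 'D_v H) (F \+ G) vs}.
  elim: vs => // v vs IH x /set_mem Ux /=.
  rewrite -deriveD; [|exact: diff_derivable (sF vs x Ux)
                     |exact: diff_derivable (sG vs x Ux)].
  exact/near_eq_derive/(open_near_eq oU Ux IH).
move=> vs x Ux; apply: (near_eq_differentiable (open_near_eq oU Ux (iterD vs))).
by apply: differentiableD; [exact: sF|exact: sG].
Qed.

(** The difference quotients of the two sides coincide term by term, so the identity holds for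
    arbitrary [F]. *)
Lemma derive_comp_affine {V' V W : normedModType R} (L : V' -> V)
    (phi : V' -> V) (F : V -> W) (x v : V') :
  (forall k v x, phi (k *: v + x) = k *: L v + phi x) ->
  'D_v (F \o phi) x = 'D_(L v) F (phi x).
Proof.
by move=> phiE; rewrite /derive /=; under [in LHS]eq_fun do rewrite phiE.
Qed.

(** Iterated derivatives of [F \o phi] along [vs] are those of [F] along [map L vs], composed with
    [phi]. This serves both for the inclusions of slices and for the projections of a product. *)
Lemma smooth_on_affine {V' V W : normedModType R} (L : V' -> V)
    (phi : V' -> V) (U' : set V') (U : set V) (F : V -> W) :
  (forall k v x, phi (k *: v + x) = k *: L v + phi x) ->
  (forall x, differentiable phi x) -> U' `<=` phi @^-1` U ->
  smooth_on U F -> smooth_on U' (F \o phi).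
Proof.
move=> phiE dphi UU sF vs x U'x.
suff -> : foldr (fun v H => 'D_v H) (F \o phi) vs =
    foldr (fun v H => 'D_v H) F (map L vs) \o phi.
  by apply: differentiable_comp; [exact: dphi | apply: sF; exact: UU].
elim: vs {U'x} => //= v vs ->; apply/funext => y.
by rewrite (derive_comp_affine _ _ _ phiE).
Qed.

End SmoothOn.

(** * Atlases *)

(** A condition on charts alone, with no topology on [T]: it passes to products and covers [I], [M]
    and [I * M] uniformly. *)
Definition differentiable_atlas (R : realType) (T : Type) (n : nat)
    (A : atlas R T n) : Prop :=
  [/\ forall (i : chart A) (x : 'rV[R]_n) (p : T),
        point i x = Some p <-> dom i p /\ coord i p = x,
      forall p, dom (chart_at A p) p,
      forall i j : chart A, open (coord i @` (dom i `&` dom j))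
    & forall (i j : chart A) (p : T), dom i p -> dom j p ->
        differentiable (transition i j) (coord i p)].

(** The flat connection of the preferred chart at [p], evaluated at [p]. Its antisymmetrization is
    [lie_bracket]. *)
Definition chart_derive (R : realType) (T : Type) (n : nat) (A : atlas R T n)
    (X Y : T -> 'rV[R]_n) (p : T) : 'rV[R]_n :=
  let c := chart_at A p in 'D_(X p) (in_coord c (field_comp c Y)) (coord c p).

Lemma smooth_manifold_differentiable (R : realType) (M : topologicalType)
    (n : nat) (A : atlas R M n) : smooth_manifold A -> differentiable_atlas A.
Proof.
case=> _ _ [hdom hpoint hat htrans]; split=> // [i j|i j p dip djp].
  have [odi [_ openi]] := hdom i; have [odj _] := hdom j.
  by apply: openi; [exact: openI|move=> ? []].
by apply: (htrans i j [::]); exists p.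
Qed.

Section Atlas.
Context {R : realType} {T : Type} {n : nat} (A : atlas R T n).
Hypothesis hA : differentiable_atlas A.
Implicit Types (i j : chart A) (p : T) (X Y Z : T -> 'rV[R]_n).

Lemma point_coord i p : dom i p -> point i (coord i p) = Some p.
Proof. by case: hA => hpoint _ _ _ dip; apply/hpoint. Qed.

Lemma in_coord_coord {W : normedModType R} i (F : T -> W) p :
  dom i p -> in_coord i F (coord i p) = F p.
Proof. by move=> dip; rewrite /in_coord point_coord. Qed.

Lemma chart_range_open i : open (chart_range i).
Proof.
by case: hA => _ _ + _ => /(_ i i); rewrite setIid.
Qed.

Lemma nbhs_chart_range i p : dom i p -> nbhs (coord i p) (chart_range i).
Proof.
move=> dip; apply: open_nbhs_nbhs; split; first exact: chart_range_open.
by exists p.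
Qed.

Lemma dom_chart_at p : dom (chart_at A p) p.
Proof. by case: hA. Qed.

Lemma differentiable_transition i j p : dom i p -> dom j p ->
  differentiable (transition i j) (coord i p).
Proof. by case: hA => _ _ _; exact. Qed.

Lemma jacobian_transition_id i p : dom i p ->
  'J (transition i i) (coord i p) = 1%:M.
Proof.
move=> dip; apply/row_matrixP => k; rewrite rowE -deriveEjacobian; last first.
  exact: differentiable_transition.
rewrite row1 -[RHS](derive_id (coord i p)).
apply: near_eq_derive; apply: filterS (nbhs_chart_range dip).
by move=> _ [q diq <-]; rewrite /transition in_coord_coord.
Qed.

(** The two transitions compose to the identity on the overlap, which is open in coordinates, so the
    chain rule applies. With row vectors the Jacobians multiply from left to right. *)
Lemma jacobian_transition_inv i j p : dom i p -> dom j p ->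
  'J (transition i j) (coord i p) *m 'J (transition j i) (coord j p) = 1%:M.
Proof.
move=> dip djp; have ij := differentiable_transition dip djp.
have tE : transition i j (coord i p) = coord j p.
  by rewrite /transition in_coord_coord.
have ji : differentiable (transition j i) (transition i j (coord i p)).
  by rewrite tE; exact: differentiable_transition.
rewrite -tE; apply/row_matrixP => k; rewrite rowE mulmxA -deriveEjacobian //.
rewrite row1 -deriveEjacobian // deriveE // (deriveE _ ij).
rewrite -[LHS]/(('d _ _ \o 'd _ _) _) -diff_comp // -deriveE; last first.
  exact: differentiable_comp.
rewrite -[RHS](derive_id (coord i p)).
apply: near_eq_derive.
have : nbhs (coord i p) (coord i @` (dom i `&` dom j)).
  apply: open_nbhs_nbhs; split; last by exists p.
  by case: hA.
apply: filterS => _ [q [diq djq] <-] /=.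
by rewrite /transition !in_coord_coord.
Qed.

Lemma field_comp_chart_at X p : field_comp (chart_at A p) X p = X p.
Proof.
by rewrite /field_comp jacobian_transition_id ?mulmx1 //; exact: dom_chart_at.
Qed.

Lemma tensor_comp_chart_at (b : T -> 'M[R]_n) p :
  tensor_comp (chart_at A p) b p = b p.
Proof.
rewrite /tensor_comp jacobian_transition_id; last exact: dom_chart_at.
by rewrite trmx1 mulmx1 mul1mx.
Qed.

(** The Jacobians that carry the vectors to the chart [i] cancel those that carry the tensor there.
    A pairing, defined pointwise in varying preferred charts, can thus be differentiated in one
    fixed chart. *)
Lemma pairing_chart i (b : T -> 'M[R]_n) X Y p : dom i p ->
  (field_comp i X p *m tensor_comp i b p *m (field_comp i Y p)^T) 0 0
    = pairing b X Y p.
Proof.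
move=> dip; rewrite /pairing /field_comp /tensor_comp.
have := jacobian_transition_inv (dom_chart_at p) dip.
move: ('J _ _) ('J _ _) (X p) (Y p) (b p) => P J u w B JP.
have -> : u *m J *m (P *m B *m P^T) *m (w *m J)^T =
    u *m (J *m P) *m B *m (w *m (J *m P))^T by rewrite !trmx_mul !mulmxA.
by rewrite JP !mulmx1.
Qed.

Lemma smooth_field_differentiable X p : smooth_field A X ->
  differentiable (in_coord (chart_at A p) (field_comp (chart_at A p) X))
    (coord (chart_at A p) p).
Proof.
by move=> /(_ (chart_at A p) [::]) /=; apply; exists p => //; exact: dom_chart_at.
Qed.

(** The Leibniz rule for a product of three matrices, in the chart [c] kept fixed around [p]. *)
Lemma field_app_pairing (b : T -> 'M[R]_n) X Y Z p :
  let c := chart_at A p in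
  smooth_field A Y -> smooth_field A Z ->
  differentiable (in_coord c (tensor_comp c b)) (coord c p) ->
  field_app A X (pairing b Y Z) p =
    (chart_derive A X Y p *m b p *m (Z p)^T
     + Y p *m 'D_(X p) (in_coord c (tensor_comp c b)) (coord c p) *m (Z p)^T
     + Y p *m b p *m (chart_derive A X Z p)^T) 0 0.
Proof.
move=> c sY sZ dB; rewrite /field_app -/c.
have dcp : dom c p by exact: dom_chart_at.
have dY := smooth_field_differentiable p sY.
have dZ := smooth_field_differentiable p sZ.
rewrite -/c in dY dZ.
pose Q x := in_coord c (field_comp c Y) x *m in_coord c (tensor_comp c b) x
  *m (in_coord c (field_comp c Z) x)^T.
rewrite (_ : 'D_ _ _ _ = 'D_(X p) (fun x => Q x 0 0 : R^o) (coord c p)); last first.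
  apply: near_eq_derive; apply: filterS (nbhs_chart_range dcp).
  by move=> _ [q dcq <-]; rewrite /Q !in_coord_coord // pairing_chart.
have dYB := differentiable_mulmx dY dB.
have dZT := differentiable_trmx dZ.
have dQ := differentiable_mulmx dYB dZT.
transitivity (('D_(X p) Q (coord c p)) 0 0).
  by rewrite derive_mx ?mxE //; exact: diff_derivable.
rewrite derive_mulmx // derive_trmx // derive_mulmx //.
rewrite !in_coord_coord // field_comp_chart_at.
by rewrite tensor_comp_chart_at field_comp_chart_at mulmxDl.
Qed.

End Atlas.

(** * Derivatives of block matrices *)

Section BlockDerivatives.
Context {R : realType} {V : normedModType R}.

Lemma derive_row_mx {m n p : nat} (F : V -> 'M[R]_(m, n))
    (G : V -> 'M[R]_(m, p)) (x v : V) :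
  differentiable F x -> differentiable G x ->
  'D_v (fun y => row_mx (F y) (G y)) x = row_mx ('D_v F x) ('D_v G x).
Proof.
move=> dF dG; have dFG := differentiable_row_mx dF dG.
apply/matrixP => i j; rewrite mxE.
rewrite !derive_mx; [|exact: diff_derivable..].
rewrite mxE; under eq_fun do rewrite mxE.
by case: splitP => k _; rewrite mxE.
Qed.

Lemma differentiable_block_diag {m n : nat} (F : V -> 'M[R]_m)
    (G : V -> 'M[R]_n) (x : V) :
  differentiable F x -> differentiable G x ->
  differentiable (fun y => block_mx (F y) 0 0 (G y)) x.
Proof.
move=> /differentiable_mxP dF /differentiable_mxP dG.
apply/differentiable_mxP => i j; under eq_fun do rewrite mxE.
by case: splitP => k _; under eq_fun do rewrite mxE; case: splitP.
Qed.

Lemma derive_block_diag {m n : nat} (F : V -> 'M[R]_m) (G : V -> 'M[R]_n)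
    (x v : V) :
  differentiable F x -> differentiable G x ->
  'D_v (fun y => block_mx (F y) 0 0 (G y)) x =
    block_mx ('D_v F x) 0 0 ('D_v G x).
Proof.
move=> dF dG; have dFG := differentiable_block_diag dF dG.
apply/matrixP => i j.
rewrite !derive_mx; [|exact: diff_derivable..].
rewrite [RHS]mxE [LHS]mxE; under eq_fun do rewrite mxE.
case: splitP => k _; rewrite mxE; under eq_fun do rewrite mxE.
  by case: splitP => l _; rewrite mxE //; exact: derive_cst.
by case: splitP => l _; rewrite mxE //; exact: derive_cst.
Qed.

Lemma continuous_mulmxr {m n p : nat} (B : 'M[R]_(n, p)) :
  continuous (mulmxr B : 'M[R]_(m, n) -> 'M[R]_(m, p)).
Proof.
move=> x; apply: differentiable_continuous.
by apply: (@differentiable_mulmx _ _ _ _ _ id (cst B)).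
Qed.

End BlockDerivatives.

(** * Sums and differences of smooth fields *)

Section FieldAlgebra.
Context {R : realType} {T : Type} {n : nat} (A : atlas R T n).
Hypothesis hA : differentiable_atlas A.
Implicit Types X Y : T -> 'rV[R]_n.

Lemma smooth_fieldD X Y :
  smooth_field A X -> smooth_field A Y -> smooth_field A (X \+ Y).
Proof.
move=> sX sY i; have oi := chart_range_open hA (i := i).
apply: eq_smooth_on oi _ (smooth_onD oi (sX i) (sY i)).
move=> _ /set_mem [p dip <-] /=.
by rewrite !in_coord_coord // /field_comp mulmxDl.
Qed.

Lemma smooth_fieldB X Y :
  smooth_field A X -> smooth_field A Y -> smooth_field A (X \- Y).
Proof.
move=> sX sY; apply: (@smooth_fieldD X (fun p => - Y p)) => // i.
have oi := chart_range_open hA (i := i).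
(* Negation is realized as right multiplication by [(-1)%:M], a continuous linear map. *)
apply: eq_smooth_on oi _
  (smooth_on_linear oi (continuous_mulmxr (B := (-1)%:M)) (sY i)).
move=> _ /set_mem [p dip <-] /=.
by rewrite !in_coord_coord // /field_comp mul_mx_scalar scaleN1r mulNmx.
Qed.

End FieldAlgebra.

(** * Product atlases *)

Section Product.
Context {R : realType} {S T : Type} {m n : nat}.
Variables (A : atlas R S m) (B : atlas R T n).
Hypotheses (hA : differentiable_atlas A) (hB : differentiable_atlas B).
Let P := product_atlas A B.
Implicit Types (X Y : S * T -> 'rV[R]_(m + n)).

(** Freezing one coordinate turns a block of [X] into a field on a single factor, to which the
    connection of that factor applies. *)
Definition lslice X (t : T) : S -> 'rV[R]_m := fun s => lsubmx (X (s, t)).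
Definition rslice X (s : S) : T -> 'rV[R]_n := fun t => rsubmx (X (s, t)).

(** The splitting is only local: where just one of the two points leaves its chart range, the
    product transition vanishes entirely while the other side loses a single block. *)
Lemma product_transition (i i' : chart A) (j j' : chart B) s t :
  dom i s -> dom j t ->
  {near row_mx (coord i s) (coord j t),
    (fun x => row_mx (transition i i' (lsubmx x)) (transition j j' (rsubmx x)))
    =1 transition ((i, j) : chart P) (i', j')}.
Proof.
move=> dis djt; apply: (@filterS _ _ _ ((lsubmx @^-1` chart_range i) `&`
   (rsubmx @^-1` chart_range j))); last first.
  apply: filterI.
    by apply: continuous_lsubmx; rewrite row_mxKl; exact: nbhs_chart_range.
  by apply: continuous_rsubmx; rewrite row_mxKr; exact: nbhs_chart_range.
move=> x [[s' dis' xl] [t' djt' xr]].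
by rewrite /transition /in_coord /= -xl -xr !point_coord.
Qed.

Lemma product_atlas_differentiable : differentiable_atlas P.
Proof.
split.
- move=> [i j] x [s t] /=; split.
    case Es : (point i _) => [s'|//]; case Et : (point j _) => [t'|//] [<- <-].
    case: hA hB => [hpA _ _ _] [hpB _ _ _].
    have [dis xl] := (hpA _ _ _).1 Es; have [djt xr] := (hpB _ _ _).1 Et.
    by split => //; rewrite xl xr hsubmxK.
  by case=> -[/= dis djt] <-; rewrite row_mxKl row_mxKr !point_coord.
- by move=> p; split; exact: dom_chart_at.
- move=> [i j] [i' j'].
  have -> : coord ((i, j) : chart P) @` (dom ((i, j) : chart P) `&` dom ((i', j') : chart P)) =
      (lsubmx @^-1` (coord i @` (dom i `&` dom i'))) `&`
      (rsubmx @^-1` (coord j @` (dom j `&` dom j'))).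
    apply/seteqP; split=> [_ [[s t] [[/= ? ?] [/= ? ?]] <-]|x].
      by split; rewrite /= ?row_mxKl ?row_mxKr; [exists s|exists t].
    move=> [[s [? ?] xl] [t [? ?] xr]]; exists (s, t) => //=.
    by rewrite xl xr hsubmxK.
  case: hA hB => [_ _ oA _] [_ _ oB _].
  apply: openI; apply: open_comp => //.
    by move=> ? _; exact: continuous_lsubmx.
  by move=> ? _; exact: continuous_rsubmx.
- move=> [i j] [i' j'] [s t] [/= dis djt] [/= dis' djt'].
  apply: (near_eq_differentiable (product_transition _ _ dis djt)).
  apply: differentiable_row_mx.
    apply: (@differentiable_comp _ _ _ _ lsubmx) => //.
      exact: differentiable_lsubmx.
    by rewrite row_mxKl; exact: differentiable_transition.
  apply: (@differentiable_comp _ _ _ _ rsubmx) => //.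
    exact: differentiable_rsubmx.
  by rewrite row_mxKr; exact: differentiable_transition.
Qed.

End Product.

(** * Jacobians, tensors and smooth fields in product charts *)

Section Product.
Context {R : realType} {S T : Type} {m n : nat}.
Variables (A : atlas R S m) (B : atlas R T n).
Hypotheses (hA : differentiable_atlas A) (hB : differentiable_atlas B).
Let P := product_atlas A B.
Let hP : differentiable_atlas P := product_atlas_differentiable hA hB.
Implicit Types (X Y : S * T -> 'rV[R]_(m + n)).

Lemma derive_comp_lsubmx {W : normedModType R} (F : 'rV[R]_m -> W)
    (x v : 'rV[R]_(m + n)) :
  'D_v (F \o lsubmx) x = 'D_(lsubmx v) F (lsubmx x).
Proof. by apply: derive_comp_affine => k u y; rewrite linearP. Qed.

Lemma derive_comp_rsubmx {W : normedModType R} (F : 'rV[R]_n -> W)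
    (x v : 'rV[R]_(m + n)) :
  'D_v (F \o rsubmx) x = 'D_(rsubmx v) F (rsubmx x).
Proof. by apply: derive_comp_affine => k u y; rewrite linearP. Qed.

Lemma differentiable_comp_lsubmx {W : normedModType R} (F : 'rV[R]_m -> W)
    (x : 'rV[R]_(m + n)) :
  differentiable F (lsubmx x) -> differentiable (F \o lsubmx) x.
Proof.
by move=> dF; apply: differentiable_comp => //; exact: differentiable_lsubmx.
Qed.

Lemma differentiable_comp_rsubmx {W : normedModType R} (F : 'rV[R]_n -> W)
    (x : 'rV[R]_(m + n)) :
  differentiable F (rsubmx x) -> differentiable (F \o rsubmx) x.
Proof.
by move=> dF; apply: differentiable_comp => //; exact: differentiable_rsubmx.
Qed.

Lemma product_jacobian (i i' : chart A) (j j' : chart B) s t :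
  dom i s -> dom i' s -> dom j t -> dom j' t ->
  'J (transition ((i, j) : chart P) (i', j')) (row_mx (coord i s) (coord j t))
    = block_mx ('J (transition i i') (coord i s)) 0
               0 ('J (transition j j') (coord j t)).
Proof.
move=> dis di's djt dj't.
have dl : differentiable (transition i i' \o lsubmx) (row_mx (coord i s) (coord j t)).
  apply: differentiable_comp_lsubmx; rewrite row_mxKl.
  exact: differentiable_transition.
have dr : differentiable (transition j j' \o rsubmx) (row_mx (coord i s) (coord j t)).
  apply: differentiable_comp_rsubmx; rewrite row_mxKr.
  exact: differentiable_transition.
have near_tr := product_transition hA hB i' j' dis djt.
apply/row_matrixP => k; rewrite !rowE -deriveEjacobian; last first.
  exact: (near_eq_differentiable near_tr (differentiable_row_mx dl dr)).
rewrite -(near_eq_derive _ near_tr) (derive_row_mx _ dl dr).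
rewrite derive_comp_lsubmx derive_comp_rsubmx row_mxKl row_mxKr.
rewrite -[X in _ = X *m _]hsubmxK mul_row_block !mulmx0 addr0 add0r.
by rewrite -!deriveEjacobian //; exact: differentiable_transition.
Qed.

Lemma product_field_comp (i : chart A) (j : chart B) X s t :
  dom i s -> dom j t ->
  field_comp ((i, j) : chart P) X (s, t) =
    row_mx (field_comp i (lslice X t) s) (field_comp j (rslice X s) t).
Proof.
move=> dis djt; rewrite /field_comp /=.
rewrite product_jacobian //; do ?exact: dom_chart_at.
rewrite -[X in X *m _]hsubmxK mul_row_block !mulmx0 addr0 add0r //.
Qed.

Lemma product_tensor_comp (i : chart A) (j : chart B) (f : T -> R)
    (gS : S -> 'M[R]_m) (sigma : S -> R) (gT : T -> 'M[R]_n) s t :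
  dom i s -> dom j t ->
  tensor_comp ((i, j) : chart P) (doubly_warped_metric f gS sigma gT) (s, t) =
    block_mx (f t ^+ 2 *: tensor_comp i gS s) 0
             0 (sigma s ^+ 2 *: tensor_comp j gT t).
Proof.
move=> dis djt; rewrite /tensor_comp /=.
rewrite product_jacobian //; do ?exact: dom_chart_at.
rewrite tr_block_mx !trmx0 /doubly_warped_metric /= !mulmx_block.
rewrite !(mulmx0, mul0mx, addr0, add0r).
by rewrite -!scalemxAr -!scalemxAl.
Qed.

(** In coordinates the slice is [X] restricted along the affine inclusion [phi], followed by the
    projection to the first block. *)
Lemma smooth_lslice X t : smooth_field P X -> smooth_field A (lslice X t).
Proof.
move=> sX i; have oi := chart_range_open hA (i := i).
set j := chart_at B t; have djt : dom j t by exact: dom_chart_at.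
pose phi (x : 'rV[R]_m) := row_mx x (coord j t).
have sphi : smooth_on (chart_range i)
    (in_coord ((i, j) : chart P) (field_comp ((i, j) : chart P) X) \o phi).
  apply: (smooth_on_affine (L := fun u => row_mx u 0)) (sX (i, j)).
  - by move=> k u x; rewrite /phi scale_row_mx add_row_mx scaler0 add0r.
  - move=> x; apply: differentiable_row_mx => //; exact: differentiable_cst.
  - by move=> _ [s dis <-]; exists (s, t).
apply: eq_smooth_on oi _ (smooth_on_linear oi (@continuous_lsubmx _ _ _ _) sphi).
move=> _ /set_mem [s dis <-] /=.
rewrite -[phi _]/(coord ((i, j) : chart P) (s, t)).
by rewrite !in_coord_coord // product_field_comp // row_mxKl.
Qed.

Lemma smooth_rslice X s : smooth_field P X -> smooth_field B (rslice X s).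
Proof.
move=> sX j; have oj := chart_range_open hB (i := j).
set i := chart_at A s; have dis : dom i s by exact: dom_chart_at.
pose phi (y : 'rV[R]_n) := row_mx (coord i s) y.
have sphi : smooth_on (chart_range j)
    (in_coord ((i, j) : chart P) (field_comp ((i, j) : chart P) X) \o phi).
  apply: (smooth_on_affine (L := row_mx 0)) (sX (i, j)).
  - by move=> k u x; rewrite /phi scale_row_mx add_row_mx scaler0 add0r.
  - move=> x; apply: differentiable_row_mx => //; exact: differentiable_cst.
  - by move=> _ [t djt <-]; exists (s, t).
apply: eq_smooth_on oj _ (smooth_on_linear oj (@continuous_rsubmx _ _ _ _) sphi).
move=> _ /set_mem [t djt <-] /=.
rewrite -[phi _]/(coord ((i, j) : chart P) (s, t)).
by rewrite !in_coord_coord // product_field_comp // row_mxKr.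
Qed.

(** Product Jacobians are block diagonal, so this projection is the same constant matrix in every
    product chart. The lemma and its mirror image supply the test fields that detect each block of a
    vector. *)
Lemma smooth_lpart X :
  smooth_field P X -> smooth_field P (fun p => row_mx (lsubmx (X p)) 0).
Proof.
move=> sX [i j]; have oij := chart_range_open hP (i := (i, j)).
apply: eq_smooth_on oij _ (smooth_on_linear oij
  (continuous_mulmxr (B := block_mx 1%:M 0 0 0)) (sX (i, j))).
move=> _ /set_mem [[s t] [/= dis djt] <-] /=.
rewrite -[row_mx _ _]/(coord ((i, j) : chart P) (s, t)).
rewrite !in_coord_coord // !product_field_comp // mul_row_block.
rewrite !mulmx0 !addr0 mulmx1 /field_comp /lslice /rslice /=.
by rewrite row_mxKl row_mxKr mul0mx.
Qed.

Lemma smooth_rpart X :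
  smooth_field P X -> smooth_field P (fun p => row_mx 0 (rsubmx (X p))).
Proof.
move=> sX [i j]; have oij := chart_range_open hP (i := (i, j)).
apply: eq_smooth_on oij _ (smooth_on_linear oij
  (continuous_mulmxr (B := block_mx 0 0 0 1%:M)) (sX (i, j))).
move=> _ /set_mem [[s t] [/= dis djt] <-] /=.
rewrite -[row_mx _ _]/(coord ((i, j) : chart P) (s, t)).
rewrite !in_coord_coord // !product_field_comp // mul_row_block.
rewrite !mulmx0 !add0r mulmx1 /field_comp /lslice /rslice /=.
by rewrite row_mxKl row_mxKr mul0mx.
Qed.

Lemma in_coord_lift_sum (i : chart A) (j : chart B)
    (U : S -> 'rV[R]_m) (W : T -> 'rV[R]_n) :
  {in chart_range ((i, j) : chart P),
    (fun x => row_mx (in_coord i (field_comp i U) (lsubmx x))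
                     (in_coord j (field_comp j W) (rsubmx x)))
    =1 in_coord ((i, j) : chart P) (field_comp ((i, j) : chart P) (lift_sum U W))}.
Proof.
move=> _ /set_mem [[s t] [/= dis djt] <-].
rewrite row_mxKl row_mxKr -[row_mx _ _ in RHS]/(coord ((i, j) : chart P) (s, t)).
rewrite !in_coord_coord // product_field_comp //.
by rewrite /field_comp /lslice /rslice /lift_sum /= row_mxKl row_mxKr.
Qed.

Lemma smooth_lift_sum (U : S -> 'rV[R]_m) (W : T -> 'rV[R]_n) :
  smooth_field A U -> smooth_field B W -> smooth_field P (lift_sum U W).
Proof.
move=> sU sW [i j]; have oij := chart_range_open hP (i := (i, j)).
have sl : smooth_on (chart_range ((i, j) : chart P))
    (in_coord i (field_comp i U) \o lsubmx).
  apply: (smooth_on_affine (L := lsubmx)) (sU i).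
  - by move=> k u x; rewrite linearP.
  - by move=> x; exact: differentiable_lsubmx.
  - by move=> _ [[s t] [/= dis djt] <-]; exists s; rewrite //= row_mxKl.
have sr : smooth_on (chart_range ((i, j) : chart P))
    (in_coord j (field_comp j W) \o rsubmx).
  apply: (smooth_on_affine (L := rsubmx)) (sW j).
  - by move=> k u x; rewrite linearP.
  - by move=> x; exact: differentiable_rsubmx.
  - by move=> _ [[s t] [/= dis djt] <-]; exists t; rewrite //= row_mxKr.
(* The row is the sum of its two blocks, embedded by the constant matrices [row_mx 1%:M 0] and
   [row_mx 0 1%:M]. *)
apply: eq_smooth_on oij _ (smooth_onD oij
  (smooth_on_linear oij (continuous_mulmxr (B := row_mx 1%:M 0)) sl)
  (smooth_on_linear oij (continuous_mulmxr (B := row_mx 0 1%:M)) sr)).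
move=> x xU; rewrite -in_coord_lift_sum //=.
by rewrite !mul_mx_row !mulmx0 !mulmx1 add_row_mx addr0 add0r.
Qed.

End Product.

(** * Levi-Civita connections *)

Section Connections.
Context {R : realType} {T : Type} {n : nat} (A : atlas R T n).
Hypothesis hA : differentiable_atlas A.
Variables (b : T -> 'M[R]_n)
  (D : (T -> 'rV[R]_n) -> (T -> 'rV[R]_n) -> (T -> 'rV[R]_n)).
Implicit Types X Y Z : T -> 'rV[R]_n.

(** The Christoffel term of [D] in the preferred chart at [p], kept as an operation on whole fields
    so that it can be fed with slices. *)
Definition christoffel X Y (p : T) : 'rV[R]_n :=
  D X Y p - chart_derive A X Y p.

(** [D] and [chart_derive] have the same antisymmetrization, the Lie bracket, so their difference is
    symmetric. *)
Lemma christoffel_sym X Y p : torsion_free A D ->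
  smooth_field A X -> smooth_field A Y -> christoffel X Y p = christoffel Y X p.
Proof.
move=> tf sX sY; have /= := tf X Y sX sY p.
rewrite -[lie_bracket A X Y p]/(chart_derive A X Y p - chart_derive A Y X p).
rewrite /christoffel.
move: (D X Y p) (D Y X p) (chart_derive A X Y p) (chart_derive A Y X p).
move=> u v u' v' /eqP; rewrite subr_eq => /eqP ->.
by rewrite addrAC (addrAC u') subrr add0r addrC.
Qed.

Lemma pairingBl X X' Y p :
  pairing b (X \- X') Y p = pairing b X Y p - pairing b X' Y p.
Proof. by rewrite /pairing !mulmxBl !mxE. Qed.

Lemma pairingC X Y p : (b p)^T = b p -> pairing b X Y p = pairing b Y X p.
Proof.
move=> sb; rewrite /pairing -[in LHS](trmxK (_ *m (Y p)^T)).
by rewrite [LHS]mxE !trmx_mul trmxK sb mulmxA.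
Qed.

(** The classical formula for the derivative of the metric coefficients: subtract the Leibniz rule
    [field_app_pairing] from metric compatibility. *)
Lemma christoffel_metric X Y Z p :
  let c := chart_at A p in
  smooth_tensor A b -> metric_compatible A b D ->
  smooth_field A X -> smooth_field A Y -> smooth_field A Z ->
  Y p *m 'D_(X p) (in_coord c (tensor_comp c b)) (coord c p) *m (Z p)^T =
    christoffel X Y p *m b p *m (Z p)^T + Y p *m b p *m (christoffel X Z p)^T.
Proof.
move=> c sb mc sX sY sZ.
have db : differentiable (in_coord c (tensor_comp c b)) (coord c p).
  by apply: (sb c [::]); exists p => //; exact: dom_chart_at.
have := mc X Y Z sX sY sZ p; rewrite field_app_pairing // -/c.
rewrite /= /pairing /christoffel.
move: ('D_(X p) _ _) (chart_derive A X Y p) (chart_derive A X Z p) => G u w.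
move: (D X Y p) (D X Z p) (Y p) (Z p) (b p) => u' w' y z B E.
apply/matrixP => i j; rewrite !ord1 {i j}.
have -> : (w' - w)^T = w'^T - w^T by apply/matrixP => k l; rewrite !mxE.
by rewrite !mulmxBl mulmxBr; move: E; rewrite !mxE => E; lra.
Qed.

(* The difference of two torsion-free metric connections is symmetric in its
   two arguments and skew with respect to the metric, hence vanishes. *)
Lemma metric_torsion_free_unique D' X Y Z p :
  (forall q, (b q)^T = b q) ->
  torsion_free A D -> metric_compatible A b D ->
  torsion_free A D' -> metric_compatible A b D' ->
  smooth_field A X -> smooth_field A Y -> smooth_field A Z ->
  pairing b (D X Y \- D' X Y) Z p = 0.
Proof.
move=> sb tD mD tD' mD' sX sY sZ; rewrite pairingBl.
pose Q X Y Z := pairing b (D X Y) Z p - pairing b (D' X Y) Z p.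
have QC U V W : smooth_field A U -> smooth_field A V -> Q U V W = Q V U W.
  move=> sU sV; have := tD U V sU sV p; rewrite -(tD' U V sU sV p) => E.
  have : pairing b (D U V \- D V U) W p = pairing b (D' U V \- D' V U) W p.
    by rewrite /pairing E.
  by rewrite !pairingBl /Q => ?; lra.
have QN U V W : smooth_field A U -> smooth_field A V -> smooth_field A W ->
    Q U V W = - Q U W V.
  move=> sU sV sW; have := mD U V W sU sV sW p.
  rewrite (mD' U V W sU sV sW p) /= (pairingC V) // (pairingC V) // /Q => ?.
  by lra.
rewrite -/(Q X Y Z).
(* Alternating [QN] and [QC] runs through all six orders of the arguments and returns to [Q X Y Z].
   The three uses of [QN] give the sign -1, so [Q X Y Z] equals its opposite. *)
have := QN X Y Z sX sY sZ; have := QC X Z Y sX sZ; have := QN Z X Y sZ sX sY.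
have := QC Z Y X sZ sY; have := QN Y Z X sY sZ sX; have := QC Y X Z sY sX.
by move: (Q X Y Z) => *; lra.
Qed.

End Connections.

Lemma mulmx_block_diag (R : realType) (m n : nat) (M : 'M[R]_m) (N : 'M[R]_n)
    (u w : 'rV[R]_(m + n)) :
  u *m block_mx M 0 0 N *m w^T =
    lsubmx u *m M *m (lsubmx w)^T + rsubmx u *m N *m (rsubmx w)^T.
Proof.
rewrite -{1}(hsubmxK u) -{1}(hsubmxK w) tr_row_mx mul_row_block !mulmx0.
by rewrite addr0 add0r mul_row_col.
Qed.

(** * A torsion-free metric connection on the product *)

Section ProductConnection.
Context {R : realType} {S T : Type} {m n : nat}.
Variables (A : atlas R S m) (B : atlas R T n).
Hypotheses (hA : differentiable_atlas A) (hB : differentiable_atlas B).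
Let P := product_atlas A B.
Let hP : differentiable_atlas P := product_atlas_differentiable hA hB.
Variables (gS : S -> 'M[R]_m) (gT : T -> 'M[R]_n) (f : T -> R) (sigma : S -> R).
Hypotheses (gS_smooth : smooth_tensor A gS) (gT_smooth : smooth_tensor B gT).
Variables
  (DS : (S -> 'rV[R]_m) -> (S -> 'rV[R]_m) -> (S -> 'rV[R]_m))
  (DT : (T -> 'rV[R]_n) -> (T -> 'rV[R]_n) -> (T -> 'rV[R]_n)).
Hypotheses (hDS : levi_civita A gS DS) (hDT : levi_civita B gT DT).
Hypotheses (f_cst : forall t t', f t = f t')
  (sigma_cst : forall s s', sigma s = sigma s').
Let gP := doubly_warped_metric f gS sigma gT.
Implicit Types X Y Z : S * T -> 'rV[R]_(m + n).

(** Applying [DS] and [DT] to slices would miss the derivatives of each block along the other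
    factor. Hence the derivative is taken in the product chart and only the Christoffel terms are
    taken slicewise. *)
Definition product_connection X Y (p : S * T) : 'rV[R]_(m + n) :=
  chart_derive P X Y p +
  row_mx (christoffel A DS (lslice X p.2) (lslice Y p.2) p.1)
         (christoffel B DT (rslice X p.1) (rslice Y p.1) p.2).

(** The Christoffel terms are symmetric and cancel, which leaves the Lie bracket. *)
Lemma product_connection_torsion_free : torsion_free P product_connection.
Proof.
case: hDS hDT => [_ tS _] [_ tT _] X Y sX sY [s t].
rewrite /product_connection /= (christoffel_sym _ tS);
  [|exact: (smooth_lslice hA hB)..].
rewrite (christoffel_sym _ tT); [|exact: (smooth_rslice hA hB)..].
rewrite -[lie_bracket P X Y _]/(chart_derive P X Y (s, t) - chart_derive P Y X (s, t)).
by move: (row_mx _ _) (chart_derive _ _ _ _) (chart_derive _ _ _ _) => w u v;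
  rewrite opprD addrACA subrr addr0.
Qed.

Lemma derive_warped_metric s t v :
  let c := chart_at P (s, t) in
  differentiable (in_coord c (tensor_comp c gP)) (coord c (s, t)) /\
  'D_v (in_coord c (tensor_comp c gP)) (coord c (s, t)) =
    block_mx
      (f t ^+ 2 *: 'D_(lsubmx v) (in_coord c.1 (tensor_comp c.1 gS)) (coord c.1 s))
      0 0
      (sigma s ^+ 2 *: 'D_(rsubmx v) (in_coord c.2 (tensor_comp c.2 gT)) (coord c.2 t)).
Proof.
move=> c; have dcs : dom c.1 s by exact: dom_chart_at.
have dct : dom c.2 t by exact: dom_chart_at.
pose GS := in_coord c.1 (tensor_comp c.1 gS).
pose GT := in_coord c.2 (tensor_comp c.2 gT).
have dS : differentiable GS (coord c.1 s) by apply: (gS_smooth [::]); exists s.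
have dT : differentiable GT (coord c.2 t) by apply: (gT_smooth [::]); exists t.
pose FS : 'rV[R]_(m + n) -> 'M[R]_m := f t ^+ 2 \*: (GS \o lsubmx).
pose FT : 'rV[R]_(m + n) -> 'M[R]_n := sigma s ^+ 2 \*: (GT \o rsubmx).
have dlS : differentiable (GS \o lsubmx) (coord c (s, t)).
  by apply: differentiable_comp_lsubmx; rewrite row_mxKl.
have drT : differentiable (GT \o rsubmx) (coord c (s, t)).
  by apply: differentiable_comp_rsubmx; rewrite row_mxKr.
have dFS : differentiable FS (coord c (s, t)) by exact: differentiableZ.
have dFT : differentiable FT (coord c (s, t)) by exact: differentiableZ.
have nearG : {near coord c (s, t), (fun x => block_mx (FS x) 0 0 (FT x))
    =1 in_coord c (tensor_comp c gP)}.
  have dcst : dom c (s, t) by exact: dom_chart_at.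
  apply: filterS (nbhs_chart_range hP dcst) => _ [[s' t'] [/= d1 d2] <-].
  transitivity (tensor_comp c gP (s', t')); last first.
    exact: (esym (in_coord_coord hP (i := c) _ (p := (s', t')) (conj d1 d2))).
  rewrite [c]surjective_pairing product_tensor_comp //.
  rewrite /FS /FT /GS /GT /c /= row_mxKl row_mxKr !in_coord_coord //.
  (* Constancy enters here: the warping factors at the moving point agree with those frozen at
     [(s, t)] in [FS] and [FT], so they contribute no derivative. *)
  by rewrite (f_cst t t') (sigma_cst s s').
split; first exact: near_eq_differentiable nearG (differentiable_block_diag dFS dFT).
rewrite -(near_eq_derive _ nearG) derive_block_diag //.
rewrite !deriveZ; [|exact: diff_derivable..].
by rewrite derive_comp_lsubmx derive_comp_rsubmx row_mxKl row_mxKr.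
Qed.

(** Each diagonal block of the derivative of [gP] is a constant multiple of the one given by
    [christoffel_metric] on a factor. The remaining Leibniz terms are the [chart_derive] parts of
    the connection. *)
Lemma product_connection_metric : metric_compatible P gP product_connection.
Proof.
case: hDS hDT => [_ _ mS] [_ _ mT] X Y Z sX sY sZ [s t].
have [dG DG] := derive_warped_metric s t (X (s, t)).
rewrite field_app_pairing // {dG}DG.
have := christoffel_metric hA s gS_smooth mS (smooth_lslice hA hB t sX)
  (smooth_lslice hA hB t sY) (smooth_lslice hA hB t sZ).
have := christoffel_metric hB t gT_smooth mT (smooth_rslice hA hB s sX)
  (smooth_rslice hA hB s sY) (smooth_rslice hA hB s sZ).
rewrite /= /pairing /product_connection /= => ET ES.
have GE : gP (s, t) = block_mx (f t ^+ 2 *: gS s) 0 0 (sigma s ^+ 2 *: gT t).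
  by [].
(* The metric stays opaque until the [chart_derive] terms common to both sides are abstracted as [U]
   and [W]; only then is its block form expanded. *)
move: (gP (s, t)) GE => G GE.
rewrite mulmx_block_diag -!scalemxAr -!scalemxAl.
move: ES ET; rewrite /lslice /rslice => -> ->.
move: (chart_derive _ _ Y _) (chart_derive _ _ Z _) => u w.
move: (christoffel _ _ _ _ s) (christoffel _ _ _ _ s) => cl' cl.
move: (christoffel _ _ _ _ t) (christoffel _ _ _ _ t) => cr' cr.
move: (Y _) (Z _) (gS s) (gT t) (f t) (sigma s) GE => y z GS GT a b GE.
have -> : (w + row_mx cl' cr')^T = w^T + (row_mx cl' cr')^T.
  by apply/matrixP => k l; rewrite !mxE.
rewrite !mulmxDl mulmxDr.
move: (u *m G *m z^T) (y *m G *m w^T) => U W.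
rewrite GE !mulmx_block_diag !row_mxKl !row_mxKr -!scalemxAr -!scalemxAl.
by rewrite !mxE; lra.
Qed.

End ProductConnection.

(** Asking the two metrics to be anisotropic, rather than positive, puts [-dt^2] and [g] on the same
    footing. *)
Lemma product_concurrent (R : realType) (S T : Type) (m n : nat)
    (A : atlas R S m) (B : atlas R T n)
    (gS : S -> 'M[R]_m) (gT : T -> 'M[R]_n) (f : T -> R) (sigma : S -> R)
    (DS : (S -> 'rV[R]_m) -> (S -> 'rV[R]_m) -> (S -> 'rV[R]_m))
    (DT : (T -> 'rV[R]_n) -> (T -> 'rV[R]_n) -> (T -> 'rV[R]_n))
    (D : (S * T -> 'rV[R]_(m + n)) -> (S * T -> 'rV[R]_(m + n)) ->
         (S * T -> 'rV[R]_(m + n)))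
    (zS : S -> 'rV[R]_m) (zT : T -> 'rV[R]_n) :
  differentiable_atlas A -> differentiable_atlas B ->
  smooth_tensor A gS -> smooth_tensor B gT ->
  (forall s, (gS s)^T = gS s) -> (forall t, (gT t)^T = gT t) ->
  (forall s (v : 'rV_m), (v *m gS s *m v^T) 0 0 = 0 -> v = 0) ->
  (forall t (v : 'rV_n), (v *m gT t *m v^T) 0 0 = 0 -> v = 0) ->
  (forall t, f t != 0) -> (forall s, sigma s != 0) ->
  (forall t t', f t = f t') -> (forall s s', sigma s = sigma s') ->
  levi_civita A gS DS -> levi_civita B gT DT ->
  levi_civita (product_atlas A B) (doubly_warped_metric f gS sigma gT) D ->
  concurrent A DS zS -> concurrent B DT zT ->
  concurrent (product_atlas A B) D (lift_sum zS zT).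
Proof.
move=> hA hB sgS sgT symS symT aniS aniT f0 s0 fc sc hDS hDT.
case=> -[D_smooth _] tD mD [sS cS] [sT cT].
set P := product_atlas A B; set gP := doubly_warped_metric f gS sigma gT.
have hP : differentiable_atlas P by exact: product_atlas_differentiable.
set Z := lift_sum zS zT.
have sZ : smooth_field P Z by exact: smooth_lift_sum.
split=> // X sX.
pose D' := product_connection A B DS DT.
have lZ t : lslice Z t = zS by apply/funext => s; rewrite /lslice row_mxKl.
have rZ s : rslice Z s = zT by apply/funext => t; rewrite /rslice row_mxKr.
(* All slices of [Z] are [zS] or [zT], so concurrence applies on each slice. The chart derivatives
   subtracted in the Christoffel terms cancel the two blocks of the product one. *)
have D'Z p : D' X Z p = X p.
  case: p => s t; rewrite /D' /product_connection /= lZ rZ /christoffel.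
  rewrite cS; last exact: (smooth_lslice hA hB).
  rewrite cT; last exact: (smooth_rslice hA hB).
  suff -> : chart_derive P X Z (s, t) =
      row_mx (chart_derive A (lslice X t) zS s) (chart_derive B (rslice X s) zT t).
    rewrite add_row_mx; move: (chart_derive _ _ _ s) (chart_derive _ _ _ t) => u v.
    by rewrite addrC subrK (addrC v) subrK hsubmxK.
  have dcP : dom (chart_at P (s, t)) (s, t) by exact: dom_chart_at.
  have dS := smooth_field_differentiable hA s sS.
  have dT := smooth_field_differentiable hB t sT.
  have dl : differentiable (in_coord (chart_at A s) (field_comp (chart_at A s) zS)
      \o lsubmx) (coord (chart_at P (s, t)) (s, t)).
    by apply: differentiable_comp_lsubmx; rewrite row_mxKl.
  have dr : differentiable (in_coord (chart_at B t) (field_comp (chart_at B t) zT)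
      \o rsubmx) (coord (chart_at P (s, t)) (s, t)).
    by apply: differentiable_comp_rsubmx; rewrite row_mxKr.
  have rP : chart_range (chart_at P (s, t)) (coord (chart_at P (s, t)) (s, t)).
    by exists (s, t).
  have nearZ := open_near_eq (chart_range_open hP (i := chart_at P (s, t))) rP
    (in_coord_lift_sum hA hB (i := chart_at A s) (j := chart_at B t) zS zT).
  rewrite /chart_derive -(near_eq_derive _ nearZ).
  rewrite (derive_row_mx _ dl dr) derive_comp_lsubmx derive_comp_rsubmx.
  by rewrite row_mxKl row_mxKr.
have tD' : torsion_free P D' by exact: (product_connection_torsion_free hA hB hDS hDT).
have mD' : metric_compatible P gP D'
  by exact: (product_connection_metric hA hB sgS sgT hDS hDT fc sc).
pose W := D X Z \- X.
have sW : smooth_field P W by apply: (smooth_fieldB hP) => //; exact: D_smooth.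
have symP q : (gP q)^T = gP q.
  by rewrite /gP /doubly_warped_metric tr_block_mx !trmx0 !linearZ /= symS symT.
have pW Y p : smooth_field P Y -> pairing gP W Y p = 0.
  (* Since [D' X Z] equals [X], the field [W] is a difference of two torsion-free metric
     connections. *)
  move=> sY; rewrite (_ : W = D X Z \- D' X Z).
    exact: (metric_torsion_free_unique p symP tD mD tD' mD' sX sZ sY).
  by apply/funext => q; rewrite /W /= D'Z.
move=> [s t]; apply/eqP; rewrite -subr_eq0 -[_ - _]/(W (s, t)); apply/eqP.
(* The product metric may be indefinite, so [W] is paired with each of its blocks and not with
   itself; every such pairing isolates one anisotropic factor. *)
rewrite -[LHS]hsubmxK -row_mx0; congr row_mx.
  apply: (aniS s); have := pW _ (s, t) (smooth_lpart hA hB sW).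
  rewrite /pairing /gP /doubly_warped_metric /= mulmx_block_diag.
  rewrite row_mxKl row_mxKr trmx0 mulmx0 addr0 -scalemxAr -scalemxAl mxE.
  by move/eqP; rewrite mulf_eq0 sqrf_eq0 (negbTE (f0 t)) => /eqP.
apply: (aniT t); have := pW _ (s, t) (smooth_rpart hA hB sW).
rewrite /pairing /gP /doubly_warped_metric /= mulmx_block_diag.
rewrite row_mxKl row_mxKr trmx0 mulmx0 add0r -scalemxAr -scalemxAl mxE.
by move/eqP; rewrite mulf_eq0 sqrf_eq0 (negbTE (s0 s)) => /eqP.
Qed.

(** * The interval as a manifold with one chart *)

Section Interval.
Context {R : realType} (I : set R).
Hypothesis I_open : open I.

Lemma interval_point (x : 'rV[R]_1) (p : I) :
  @point _ _ _ (interval_atlas I) tt x = Some p <->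
  @dom _ _ _ (interval_atlas I) tt p /\ @coord _ _ _ (interval_atlas I) tt p = x.
Proof.
rewrite /=; split=> [|[_ <-]]; last by rewrite mxE valK.
case: insubP => // q _ qx [<-]; split=> //.
by apply/matrixP => i j; rewrite !ord1 mxE.
Qed.

Lemma interval_atlas_differentiable : differentiable_atlas (interval_atlas I).
Proof.
have openI : open ((fun x : 'rV[R]_1 => x 0 0) @^-1` I).
  by apply: open_comp => // x _; exact: coord_continuous.
have rangeE : @coord _ _ _ (interval_atlas I) tt @` setT =
    (fun x : 'rV[R]_1 => x 0 0) @^-1` I.
  apply/seteqP; split=> [_ [t _ <-]|x Ix]; first by rewrite /= mxE; exact: set_valP.
  exists (exist _ (x 0 0) (mem_set Ix)) => //.
  by apply/matrixP => i j; rewrite !ord1 mxE.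
split=> // [[] x p|[] []|[] [] p _ _]; first exact: interval_point.
  by rewrite setIT rangeE.
(* The only transition is the identity on the chart range and 0 off it, hence the identity near each
   point of the range. *)
apply: (@near_eq_differentiable _ _ _ id) => //.
have : nbhs (@coord _ _ _ (interval_atlas I) tt p) ((fun x : 'rV[R]_1 => x 0 0) @^-1` I).
  by apply: open_nbhs_nbhs; split; rewrite // -rangeE; exists p.
rewrite -rangeE; apply: filterS => _ [q _ <-].
rewrite /transition /in_coord.
by have -> := (interval_point (@coord _ _ _ (interval_atlas I) tt q) q).2 (conj Logic.I erefl).
Qed.

(** The only chart is the preferred chart at every point, so the coefficient is the constant -1 on
    the range. *)
Lemma smooth_interval_metric :
  smooth_tensor (interval_atlas I) (@interval_metric R I).
Proof.
move=> i; have hI := interval_atlas_differentiable.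
apply: eq_smooth_on (chart_range_open hI (i := i)) _
  (@smooth_on_cst _ _ _ (chart_range i) (const_mx (-1))).
move=> _ /set_mem [t _ <-]; case: i.
by rewrite (in_coord_coord hI) // (tensor_comp_chart_at hI).
Qed.

End Interval.

Theorem theorem10 (R : realType) (n : nat)
    (M : topologicalType) (A : atlas R M n) (hM : smooth_manifold A)
    (g : M -> 'M[R]_n) (hg : riemannian_metric A g)
    (I : set R) (I_open : open I) (I_connected : connected I)
    (f : M -> R) (f_smooth : smooth_fun A f) (f_gt0 : forall p, 0 < f p)
    (sigma : I -> R) (sigma_smooth : smooth_fun (interval_atlas I) sigma)
    (sigma_gt0 : forall t, 0 < sigma t)
    (h : I -> R) (h_smooth : smooth_fun (interval_atlas I) h)
    (zeta : M -> 'rV[R]_n) (zeta_smooth : smooth_field A zeta)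
    (DM : (M -> 'rV[R]_n) -> (M -> 'rV[R]_n) -> (M -> 'rV[R]_n))
    (hDM : levi_civita A g DM)
    (DI : (I -> 'rV[R]_1) -> (I -> 'rV[R]_1) -> (I -> 'rV[R]_1))
    (hDI : levi_civita (interval_atlas I) (@interval_metric R I) DI)
    (Dbar : (I * M -> 'rV[R]_(1 + n)) -> (I * M -> 'rV[R]_(1 + n)) ->
            (I * M -> 'rV[R]_(1 + n)))
    (hDbar : levi_civita (product_atlas (interval_atlas I) A)
       (doubly_warped_metric f (@interval_metric R I) sigma g) Dbar) :
  concurrent A DM zeta /\
  concurrent (interval_atlas I) DI (interval_field h) ->
  (exists c, forall p, f p = c) /\ (exists c, forall t, sigma t = c) ->
  concurrent (product_atlas (interval_atlas I) A) Dbar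
    (lift_sum (interval_field h) zeta).
Proof.
move=> [cz ch] [[c fc] [d sc]].
case: hg => g_smooth g_sym g_pos.
apply: product_concurrent hDI hDM hDbar ch cz => //.
- exact: interval_atlas_differentiable.
- exact: smooth_manifold_differentiable.
- exact: smooth_interval_metric.
- by move=> s; apply/matrixP => i j; rewrite !mxE.
(* In dimension one the form is minus the square of the single entry of [v], hence anisotropic. *)
- move=> s v; rewrite !mxE big_ord1 !mxE big_ord1 !mxE mulrN1 mulNr => /eqP.
  rewrite oppr_eq0 mulf_eq0 orbb => /eqP v0.
  by apply/matrixP => i j; rewrite !ord1 v0 mxE.
- move=> p v; have [//|v0] := eqVneq v 0.
  by move=> E; have := g_pos p v v0; rewrite E ltxx.
- by move=> p; rewrite gt_eqF.
- by move=> t; rewrite gt_eqF.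
- by move=> p q; rewrite !fc.
- by move=> s t; rewrite !sc.
Qed.
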